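(* Let $k$ be a field of characteristic $0$, and let $f_1,f_2,\ldots,f_p$ be elements of the free Novikov algebra $N_0\langle x_1,x_2,\ldots,x_n\rangle$ (without identity) over $k$, realized inside the differential polynomial algebra $k\{x_1,\ldots,x_n\}$. The elements $f_1,f_2,\ldots,f_p$ are Novikov dependent if and only if they are differentially algebraically dependent in $k\{x_1,x_2,\ldots,x_n\}$.
   Context: A (left) Novikov algebra is a nonassociative algebra $(A,\circ)$ satisfying $(a\circ b)\circ c-a\circ(b\circ c)=(b\circ a)\circ c-b\circ(a\circ c)$ and $(a\circ b)\circ c=(a\circ c)\circ b$ for all $a,b,c\in A$. $k\{x_1,\ldots,x_n\}$ is the differential polynomial algebra with one derivation $\delta$: the polynomial algebra over $k$ in independent variables $x_i^{(r)}$ ($1\le i\le n$, $r\ge 0$, $x_i^{(0)}=x_i$), with the $k$-linear derivation $\delta$ given by $\delta(x_i^{(r)})=x_i^{(r+1)}$ (so $\delta$ is zero on $k$). Write $a'=\delta(a)$ and $a^{(s)}=\delta^s(a)$. With the operation $f\circ g=f g'$, $k\{x_1,\ldots,x_n\}$ is a Novikov algebra, and $N_0\langle x_1,\ldots,x_n\rangle$ denotes its subalgebra (with respect to $\circ$) generated by $x_1,\ldots,x_n$. It is known that $N_0\langle x_1,\ldots,x_n\rangle$ is the free Novikov algebra without identity in the variables $x_1,\ldots,x_n$, and that it is the $k$-span of all differential monomials $u=x_{i_1}^{(s_1)}\cdots x_{i_t}^{(s_t)}$ with $t-(s_1+\cdots+s_t)=1$. The algebra $N\langle x_1,\ldots,x_n\rangle=k\oplus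 N_0\langle x_1,\ldots,x_n\rangle$ is obtained by formally adjoining an identity element. Elements $f_1,\ldots,f_p$ are Novikov dependent if there is a nonzero $h(z_1,\ldots,z_p)\in N\langle z_1,\ldots,z_p\rangle$ with $h(f_1,\ldots,f_p)=0$. Here, for $f_1,\ldots,f_p\in N_0\langle x_1,\ldots,x_n\rangle$, evaluation is the homomorphism $N\langle z_1,\ldots,z_p\rangle\to N\langle x_1,\ldots,x_n\rangle$ preserving the identity and sending $z_i\mapsto f_i$. Elements $f_1,\ldots,f_p\in k\{x_1,\ldots,x_n\}$ are differentially algebraically dependent if there is a nonzero $g\in k\{z_1,\ldots,z_p\}$ with $g(f_1,\ldots,f_p)=0$ (substituting $f_i^{(r)}$ for $z_i^{(r)}$). *)

(* Defs.v *)
From HB Require Import structures.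
From mathcomp Require Import all_boot all_order all_algebra.
From mathcomp Require Import finmap.
From mathcomp Require Import monalg.
From mathcomp Require Import boolp.

Set Implicit Arguments.
Unset Strict Implicit.
Unset Printing Implicit Defensive.

Import GRing.Theory.

Local Open Scope fset_scope.
Local Open Scope ring_scope.

(* The pair (i, r) : dvar n is the variable x_i^(r). *)
Definition dvar (n : nat) : choiceType := ('I_n * nat)%type.
Definition dmonom (n : nat) : conomType := {cmonom dvar n}.
Definition dpoly (k : fieldType) (n : nat) : Type := {malg k[dmonom n]}.

HB.instance Definition _ (k : fieldType) (n : nat) :=
  GRing.Zmodule.on (dpoly k n).

(* Scaling, product and monomials of {malg k[dmonom n]}, locked because failing
   conversions between them diverge otherwise. *)
HB.lock Definition dpoly_scale (k : fieldType) (n : nat) (c : k)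
  (f : dpoly k n) : dpoly k n := c *: (f : {malg k[dmonom n]}).

HB.lock Definition dpoly_mul (k : fieldType) (n : nat) (f g : dpoly k n) :
  dpoly k n := (f : {malg k[dmonom n]}) * g.

HB.lock Definition dmono (k : fieldType) (n : nat) (m : dmonom n) : dpoly k n :=
  << m >>.
Arguments dmono k {n} m.

Section Algebra.
Context {k : fieldType} {n : nat}.
Implicit Types (c : k) (f g h : dpoly k n).

Lemma dpoly_scaleA c d f :
  dpoly_scale c (dpoly_scale d f) = dpoly_scale (c * d) f.
Proof. by rewrite !dpoly_scale.unlock; apply: scalerA. Qed.

Lemma dpoly_scale1 : left_id 1 (@dpoly_scale k n).
Proof. by move=> f; rewrite !dpoly_scale.unlock; apply: scale1r. Qed.

Lemma dpoly_scaleDr : right_distributive (@dpoly_scale k n) +%R.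
Proof. by move=> c f g; rewrite !dpoly_scale.unlock; apply: scalerDr. Qed.

Lemma dpoly_scaleDl f : {morph (@dpoly_scale k n)^~ f : c d / c + d}.
Proof. by move=> c d; rewrite !dpoly_scale.unlock; apply: scalerDl. Qed.

HB.instance Definition _ := GRing.Zmodule_isLmodule.Build k (dpoly k n)
  dpoly_scaleA dpoly_scale1 dpoly_scaleDr dpoly_scaleDl.

Lemma dpoly_mulA : associative (@dpoly_mul k n).
Proof. by move=> f g h; rewrite !dpoly_mul.unlock; apply: mulrA. Qed.

Lemma dpoly_mulC : commutative (@dpoly_mul k n).
Proof. by move=> f g; rewrite !dpoly_mul.unlock; apply: mulrC. Qed.

Lemma dpoly_mul1 : left_id (dmono k (@mone (dmonom n))) (@dpoly_mul k n).
Proof. by move=> f; rewrite dmono.unlock dpoly_mul.unlock; apply: mul1r. Qed.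

Lemma dpoly_mulDl : left_distributive (@dpoly_mul k n) +%R.
Proof. by move=> f g h; rewrite !dpoly_mul.unlock; apply: mulrDl. Qed.

Lemma dpoly_oner_neq0 : dmono k (@mone (dmonom n)) != 0.
Proof. by rewrite dmono.unlock; exact: (@oner_neq0 {malg k[dmonom n]}). Qed.

HB.instance Definition _ := GRing.Zmodule_isComNzRing.Build (dpoly k n)
  dpoly_mulA dpoly_mulC dpoly_mul1 dpoly_mulDl dpoly_oner_neq0.

Lemma dpoly_scaleAl c f g : c *: dpoly_mul f g = dpoly_mul (c *: f) g.
Proof.
rewrite /GRing.scale /= !dpoly_scale.unlock !dpoly_mul.unlock.
exact: (@scalerAl k {malg k[dmonom n]}).
Qed.

HB.instance Definition _ :=
  GRing.Lmodule_isLalgebra.Build k (dpoly k n) dpoly_scaleAl.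
HB.instance Definition _ :=
  GRing.Lalgebra_isComAlgebra.Build k (dpoly k n).

End Algebra.

Section Monomials.
Context {k : fieldType} {n : nat}.
Implicit Types (c : k) (m : dmonom n) (f g : dpoly k n).

Lemma dcoefD f g m : (f + g)@_m = f@_m + g@_m.
Proof. exact: mcoeffD. Qed.

Lemma dcoefZ c f m : (c *: f)@_m = c * f@_m.
Proof. by rewrite /GRing.scale /= dpoly_scale.unlock; exact: mcoeffZ. Qed.

Lemma dcoef_dmono m m' : (dmono k m)@_m' = (m == m')%:R.
Proof. by rewrite dmono.unlock; exact: mcoeffU. Qed.

Lemma dpolyP f g : (forall m, f@_m = g@_m) -> f = g.
Proof. by move=> fg; apply/malgP. Qed.

Lemma dsuppD f g : msupp (f + g) `<=` msupp f `|` msupp g.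
Proof. exact: msuppD_le. Qed.

Lemma dsuppZ c f : msupp (c *: f) `<=` msupp f.
Proof. by rewrite /GRing.scale /= dpoly_scale.unlock; exact: msuppZ_le. Qed.

Lemma dsupp_dmono m : msupp (dmono k m) = [fset m].
Proof. by rewrite dmono.unlock; exact: msuppU1. Qed.

Lemma dmonoM m1 m2 : dmono k (mmul m1 m2) = dmono k m1 * dmono k m2.
Proof.
rewrite /GRing.mul /= dpoly_mul.unlock dmono.unlock; apply: esym.
by apply: etrans (malgM_def _ _) _; rewrite fgmulUU mulr1.
Qed.

Lemma dmono1 : dmono k (@mone (dmonom n)) = 1.
Proof. by []. Qed.

Lemma dmonoZ c m (f : dpoly k n) : f = << c *g m >> -> f = c *: dmono k m.
Proof.
move=> fE; apply: dpolyP => m'.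
by rewrite dcoefZ dcoef_dmono mulr_natr fE mcoeffU.
Qed.

Lemma dpolyE f : f = \sum_(m <- msupp f) f@_m *: dmono k m.
Proof. by rewrite [LHS](monalgE f); apply: eq_bigr => m _; apply: dmonoZ. Qed.

Lemma dpoly_ind (P : dpoly k n -> Prop) :
  P 0 -> (forall c m f, P f -> P (c *: dmono k m + f)) -> forall f, P f.
Proof.
by move=> P0 PS f; rewrite (dpolyE f); apply: big_rec => // m g _; apply: PS.
Qed.

Lemma dpoly_sumEw (V : lmodType k) (h : dmonom n -> V) (d : {fset dmonom n}) f :
  msupp f `<=` d ->
  \sum_(m <- msupp f) f@_m *: h m = \sum_(m <- d) f@_m *: h m.
Proof.
move=> le; rewrite [LHS](big_fset_incl _ le) //= => m _ /mcoeff_outdom ->.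
by rewrite scale0r.
Qed.

Lemma dpoly_sum_is_linear (V : lmodType k) (h : dmonom n -> V) :
  linear (fun f : dpoly k n => \sum_(m <- msupp f) f@_m *: h m).
Proof.
move=> c f g.
have hf : msupp f `<=` msupp f `|` msupp g by rewrite fsubsetUl.
have hg : msupp g `<=` msupp f `|` msupp g by rewrite fsubsetUr.
have hfg : msupp (c *: f + g) `<=` msupp f `|` msupp g.
  by apply: fsubset_trans (dsuppD _ _) _; apply: fsetSU; apply: dsuppZ.
rewrite (dpoly_sumEw _ hf) (dpoly_sumEw _ hg) (dpoly_sumEw _ hfg).
rewrite scaler_sumr -big_split.
by apply: eq_bigr => m _; rewrite dcoefD dcoefZ scalerDl scalerA.
Qed.

Lemma dpoly_sum_dmono (V : lmodType k) (h : dmonom n -> V) m :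
  \sum_(u <- msupp (dmono k m)) (dmono k m)@_u *: h u = h m.
Proof.
by rewrite dsupp_dmono big_seq_fset1 dcoef_dmono eqxx scale1r.
Qed.

Lemma dmonom_ind (P : dmonom n -> Prop) :
  P (@mone (dmonom n)) -> (forall v m, P m -> P (mmul (ucm v) m)) ->
  forall m, P m.
Proof.
move=> P1 PS m; have [d] := ubnP (mdeg m); elim: d m => // d IHd m.
have [->|m1] := eqVneq m (@mone (dmonom n)); first by [].
have [v mv] : exists v, v \in finsupp m.
  case: (fset_0Vmem (finsupp m)) => [m0|[v mv]]; last by exists v.
  by move: m1; rewrite -(mdeg_eq0 m) mdegE m0 big_seq_fset0.
have -> : m = mmul (ucm v) (divcm m (ucm v)).
  apply/eqP/cmP => w; rewrite cmM divcmE cmU subnKC //.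
  by case: eqP => // <-; rewrite lt0n cmE_neq0.
by rewrite mdegM mdegU => lt_m; apply/PS/IHd.
Qed.

Definition dX (v : dvar n) : dpoly k n := dmono k (ucm v).

End Monomials.
Arguments dX k {n} v.

Section Derivation.
Context {k : fieldType} {n : nat}.
Implicit Types (v : dvar n) (m : dmonom n) (f g : dpoly k n).

Definition dshift v : dvar n := (v.1, v.2.+1).

(* delta m = \sum_v (m v) (m / v) v'; the division divcm m (ucm v) is exact,
   v being a variable of m. *)
Definition delta_mono m : dpoly k n :=
  \sum_(v <- finsupp m)
    (m v)%:R *: (dmono k (divcm m (ucm v)) * dX k (dshift v)).

Definition delta f : dpoly k n := \sum_(m <- msupp f) f@_m *: delta_mono m.

Lemma delta_is_linear : linear delta.
Proof. exact: dpoly_sum_is_linear. Qed.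

HB.instance Definition _ :=
  GRing.isLinear.Build k (dpoly k n) (dpoly k n) *:%R delta delta_is_linear.

Lemma delta_dmono m : delta (dmono k m) = delta_mono m.
Proof. exact: dpoly_sum_dmono. Qed.

Lemma delta_dX v : delta (dX k v) = dX k (dshift v).
Proof.
rewrite delta_dmono /delta_mono mdomU big_seq_fset1 cmUU scale1r.
have -> : divcm (ucm v) (ucm v) = @mone (dmonom n).
  by apply/eqP/cmP => w; rewrite divcmE subnn cm1.
by rewrite dmono1 mul1r.
Qed.

Lemma delta_monoEw (d : {fset dvar n}) m : finsupp m `<=` d -> delta_mono m =
  \sum_(v <- d) (m v)%:R *: (dmono k (divcm m (ucm v)) * dX k (dshift v)).
Proof.
move=> le; rewrite [LHS](big_fset_incl _ le) //= => v _.
by rewrite -cmE_eq0 => /eqP ->; rewrite scale0r.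
Qed.

Lemma divcm_mull m1 m2 v : m1 v != 0%N ->
  divcm (mmul m1 m2) (ucm v) = mmul (divcm m1 (ucm v)) m2 :> dmonom n.
Proof.
move=> m1v; apply/eqP/cmP => w; rewrite divcmE !cmM divcmE cmU.
case: eqP => [<-|_]; last by rewrite !subn0.
by rewrite addnBAC // lt0n.
Qed.

Lemma delta_monoM m1 m2 : delta_mono (mmul m1 m2) =
  delta_mono m1 * dmono k m2 + dmono k m1 * delta_mono m2.
Proof.
have h1 : finsupp m1 `<=` finsupp (mmul m1 m2) by rewrite mdomD fsubsetUl.
have h2 : finsupp m2 `<=` finsupp (mmul m1 m2) by rewrite mdomD fsubsetUr.
rewrite (delta_monoEw h1) (delta_monoEw h2) mulr_suml mulr_sumr -big_split /=.
apply: eq_bigr => v _; rewrite cmM natrD scalerDl.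
congr (_ + _).
- have [->|m1v] := eqVneq (m1 v) 0%N; first by rewrite !scale0r mul0r.
  by rewrite divcm_mull // dmonoM -scalerAl mulrAC.
- have [->|m2v] := eqVneq (m2 v) 0%N; first by rewrite !scale0r mulr0.
  rewrite [mmul m1 m2]mulmC divcm_mull // dmonoM -scalerAr; congr (_ *: _).
  by rewrite mulrA [_ * dmono k m1]mulrC.
Qed.

Lemma deltaM f g : delta (f * g) = delta f * g + f * delta g.
Proof.
elim/(@dpoly_ind k n): f => [|c m1 f IHf]; first by rewrite !(mul0r, linear0) addr0.
rewrite !(mulrDl, linearD) /= {}IHf addrACA; congr (_ + _).
rewrite -scalerAl !linearZ /= -!scalerAl -scalerDr; congr (_ *: _).
elim/(@dpoly_ind k n): g => [|d m2 g IHg]; first by rewrite !(mulr0, linear0) addr0.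
rewrite !(mulrDr, linearD) /= {}IHg addrACA; congr (_ + _).
rewrite -scalerAr !linearZ /= -!scalerAr -scalerDr; congr (_ *: _).
by rewrite -dmonoM !delta_dmono delta_monoM.
Qed.

Definition dcirc f g : dpoly k n := f * delta g.

Lemma delta1 : delta 1 = 0.
Proof.
apply: (addIr (delta 1)).
by rewrite add0r -[in RHS](mulr1 1) deltaM mulr1 mul1r.
Qed.

End Derivation.

Section Substitution.
Context {k : fieldType} {p n : nat} (f : 'I_p -> dpoly k n).
Implicit Types (m : dmonom p) (g : dpoly k p).

Definition dsubst_mono m : dpoly k n :=
  \prod_(v <- finsupp m) iter v.2 delta (f v.1) ^+ m v.

(* The substitution z_i^(r) |-> f_i^(r). *)
Definition dsubst g : dpoly k n := \sum_(m <- msupp g) g@_m *: dsubst_mono m.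

Lemma dsubst_is_linear : linear dsubst.
Proof. exact: dpoly_sum_is_linear. Qed.

HB.instance Definition _ :=
  GRing.isLinear.Build k (dpoly k p) (dpoly k n) *:%R dsubst dsubst_is_linear.

Lemma dsubst_dmono m : dsubst (dmono k m) = dsubst_mono m.
Proof. exact: dpoly_sum_dmono. Qed.

Lemma dsubst_monoEw (d : {fset dvar p}) m : finsupp m `<=` d ->
  dsubst_mono m = \prod_(v <- d) iter v.2 delta (f v.1) ^+ m v.
Proof.
move=> le; rewrite [LHS](big_fset_incl _ le) //= => v _.
by rewrite -cmE_eq0 => /eqP ->; rewrite expr0.
Qed.

Lemma dsubst_monoM m1 m2 :
  dsubst_mono (mmul m1 m2) = dsubst_mono m1 * dsubst_mono m2.
Proof.
have h1 : finsupp m1 `<=` finsupp (mmul m1 m2) by rewrite mdomD fsubsetUl.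
have h2 : finsupp m2 `<=` finsupp (mmul m1 m2) by rewrite mdomD fsubsetUr.
rewrite (dsubst_monoEw h1) (dsubst_monoEw h2) -big_split /=.
by apply: eq_bigr => v _; rewrite cmM exprD.
Qed.

Lemma dsubst_is_monoid_morphism : monoid_morphism dsubst.
Proof.
split=> [|g h].
  by rewrite -dmono1 dsubst_dmono /dsubst_mono mdom1 big_seq_fset0.
elim/(@dpoly_ind k p): g => [|c m1 g IHg]; first by rewrite !(mul0r, linear0).
rewrite !(mulrDl, linearD) /= {}IHg; congr (_ + _).
rewrite -scalerAl !linearZ /= -scalerAl; congr (_ *: _).
elim/(@dpoly_ind k p): h => [|d m2 h IHh]; first by rewrite !(mulr0, linear0).
rewrite !(mulrDr, linearD) /= {}IHh; congr (_ + _).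
rewrite -scalerAr !linearZ /= -scalerAr; congr (_ *: _).
by rewrite -dmonoM !dsubst_dmono dsubst_monoM.
Qed.

HB.instance Definition _ :=
  GRing.isMonoidMorphism.Build (dpoly k p) (dpoly k n) dsubst
    dsubst_is_monoid_morphism.

Lemma dsubst_dX v : dsubst (dX k v) = iter v.2 delta (f v.1).
Proof. by rewrite dsubst_dmono /dsubst_mono mdomU big_seq_fset1 cmUU. Qed.

Lemma dsubst_delta g : dsubst (delta g) = delta (dsubst g).
Proof.
elim/(@dpoly_ind k p): g => [|c m g IHg]; first by rewrite !linear0.
rewrite !linearD /= {}IHg !linearZ /=; congr (_ *: _ + _).
elim/(@dmonom_ind p): m => [|v m IHm].
  by rewrite dmono1 rmorph1 !delta1 linear0.
rewrite dmonoM deltaM rmorphD !rmorphM /= IHm deltaM; congr (_ * _ + _).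
by rewrite -/(dX k v) delta_dX !dsubst_dX.
Qed.

End Substitution.

Section NovikovWithoutIdentity.
Context (k : fieldType) (n : nat).

(* The subalgebra of (dpoly k n, dcirc) generated by x_1, ..., x_n. *)
Inductive novikov0_gen : dpoly k n -> Prop :=
| novikov0_gen_var i : novikov0_gen (dX k (i, 0%N))
| novikov0_gen0 : novikov0_gen 0
| novikov0_gen_lin c f g :
    novikov0_gen f -> novikov0_gen g -> novikov0_gen (c *: f + g)
| novikov0_gen_circ f g :
    novikov0_gen f -> novikov0_gen g -> novikov0_gen (dcirc f g).

Definition novikov0_pred : {pred dpoly k n} := fun f => `[< novikov0_gen f >].

Lemma novikov0_submod_closed : submod_closed novikov0_pred.
Proof.
split=> [|c f g /asboolP gf /asboolP gg]; apply/asboolP.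
  exact: novikov0_gen0.
exact: novikov0_gen_lin.
Qed.

HB.instance Definition _ := GRing.isSubmodClosed.Build k (dpoly k n)
  novikov0_pred novikov0_submod_closed.

Record novikov0 := Novikov0 {
  novikov0_val :> dpoly k n;
  novikov0_valP : novikov0_val \in novikov0_pred
}.

HB.instance Definition _ := [isSub for novikov0_val].
HB.instance Definition _ := [Choice of novikov0 by <:].
HB.instance Definition _ := [SubChoice_isSubLmodule of novikov0 by <:].

End NovikovWithoutIdentity.
Arguments novikov0_pred : clear implicits.

Section Novikov.
Context {k : fieldType} {n : nat}.

Lemma nvar_subproof (i : 'I_n) : dX k (i, 0%N) \in novikov0_pred k n.
Proof. exact/asboolP/novikov0_gen_var. Qed.

Definition nvar (i : 'I_n) : novikov0 k n := Novikov0 (nvar_subproof i).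

Lemma ncirc_subproof (f g : novikov0 k n) : dcirc f g \in novikov0_pred k n.
Proof.
have /asboolP gf := novikov0_valP f; have /asboolP gg := novikov0_valP g.
exact/asboolP/novikov0_gen_circ.
Qed.

Definition ncirc (f g : novikov0 k n) : novikov0 k n :=
  Novikov0 (ncirc_subproof f g).

End Novikov.
Arguments nvar k {n} i.

(* k (+) N_0<x_1, ..., x_n>: the pair (c, f) is c 1 + f. *)
Definition novikov (k : fieldType) (n : nat) : Type := (k^o * novikov0 k n)%type.

HB.instance Definition _ (k : fieldType) (n : nat) :=
  GRing.Lmodule.on (novikov k n).

Section NovikovIdentity.
Context {k : fieldType} {n : nat}.
Implicit Types u v : novikov k n.

Definition nunit : novikov k n := (1, 0).

Definition ninj (f : novikov0 k n) : novikov k n := (0, f).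

Definition nmul u v : novikov k n :=
  (u.1 * v.1, (u.1 : k) *: v.2 + (v.1 : k) *: u.2 + ncirc u.2 v.2).

End NovikovIdentity.

Section Evaluation.
Context {k : fieldType} {p n : nat} (f : 'I_p -> novikov0 k n).

(* phi is the evaluation h |-> h(f_1, ..., f_p). *)
Record is_novikov_eval (phi : novikov k p -> novikov k n) : Prop := {
  novikov_eval_linear : linear phi;
  novikov_eval_mul : {morph phi : u v / nmul u v};
  novikov_eval1 : phi nunit = nunit;
  novikov_eval_var : forall i, phi (ninj (nvar k i)) = ninj (f i)
}.

Lemma novikov0_gen_elim (P : novikov0 k p -> Prop) :
  (forall i, P (nvar k i)) -> P 0 ->
  (forall c g h, P g -> P h -> P (c *: g + h)) ->
  (forall g h, P g -> P h -> P (ncirc g h)) -> forall g, P g.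
Proof.
move=> Pvar P0 Plin Pcirc [g gP]; have gg := gP; move/asboolP: gg => gg.
suff [gP' Pg] : exists gP', P (@Novikov0 k p g gP').
  by rewrite (bool_irrelevance gP gP').
elim: gg {gP} => [i||c {}g h _ [gP Pg] _ [hP Ph]|{}g h _ [gP Pg] _ [hP Ph]].
- by exists (nvar_subproof i); apply: Pvar.
- have E : (0 : novikov0 k p) = Novikov0 (novikov0_valP 0) by apply: val_inj.
  by exists (novikov0_valP 0); rewrite -E.
- have /= cP := novikov0_valP (c *: Novikov0 gP + Novikov0 hP).
  exists cP; have -> : Novikov0 cP = c *: Novikov0 gP + Novikov0 hP.
    exact: val_inj.
  exact: Plin.
- exists (ncirc_subproof (Novikov0 gP) (Novikov0 hP)).
  exact: (Pcirc (Novikov0 gP) (Novikov0 hP)).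
Qed.

Lemma is_novikov_eval_uniq phi psi :
  is_novikov_eval phi -> is_novikov_eval psi -> phi =1 psi.
Proof.
case=> lphi mphi phi1 phiX [lpsi mpsi psi1 psiX] [c g].
have z0 chi : linear chi -> chi (0 : novikov k p) = 0 :> novikov k n.
  move=> lchi; have := lchi (-1) 0 0.
  by rewrite scaleN1r addNr => ->; rewrite scaleN1r addNr.
have -> : (c, g) = (c : k) *: nunit + ninj g :> novikov k p.
  congr pair; first by rewrite /= addr0; apply/esym/mulr1.
  by rewrite /= scaler0 add0r.
rewrite lphi lpsi phi1 psi1; congr (_ + _).
elim/novikov0_gen_elim: g => [i||d g h IHg IHh|g h IHg IHh].
- by rewrite phiX psiX.
- by rewrite !z0.
- have -> : ninj (d *: g + h) = d *: ninj g + ninj h :> novikov k p.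
    by congr pair; rewrite /= addr0; apply/esym/mulr0.
  by rewrite lphi lpsi IHg IHh.
- have -> : ninj (ncirc g h) = nmul (ninj g) (ninj h) :> novikov k p.
    by congr pair; rewrite /= ?mul0r // !scale0r !add0r.
  by rewrite mphi mpsi IHg IHh.
Qed.

Lemma dsubst_novikov0 (g : novikov0 k p) :
  dsubst (fun i => f i) g \in novikov0_pred k n.
Proof.
elim/novikov0_gen_elim: g => [i||c g h IHg IHh|g h /asboolP IHg /asboolP IHh].
- by rewrite /= dsubst_dX /=; apply: novikov0_valP.
- by rewrite linear0 rpred0.
- by rewrite linearP rpredD ?rpredZ.
- apply/asboolP; rewrite /= /dcirc rmorphM /= dsubst_delta.
  exact: novikov0_gen_circ.
Qed.

Lemma is_novikov_eval_exists : exists phi, is_novikov_eval phi.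
Proof.
exists (fun u => (u.1, Novikov0 (dsubst_novikov0 u.2))); split.
- move=> c [a g] [b h]; congr pair; apply: val_inj => /=.
  by rewrite linearP.
- move=> [a g] [b h]; congr pair; apply: val_inj => /=.
  by rewrite !linearD !linearZ /= /dcirc rmorphM /= dsubst_delta.
- by congr pair; apply: val_inj; rewrite /= linear0.
- by move=> i; congr pair; apply: val_inj; rewrite /= dsubst_dX.
Qed.

(* By the two previous results, there is exactly one such phi. *)
Definition novikov_dependent : Prop :=
  exists phi : novikov k p -> novikov k n, is_novikov_eval phi /\
    exists h : novikov k p, h != 0 /\ phi h = 0.

End Evaluation.

Definition diff_alg_dependent (k : fieldType) (p n : nat)
    (f : 'I_p -> dpoly k n) : Prop :=
  exists g : dpoly k p, g != 0 /\ dsubst f g = 0.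

(* Main.v *)
From HB Require Import structures.
Require Import Defs.
From mathcomp Require Import all_boot all_order all_algebra.
From mathcomp Require Import finmap monalg boolp.
From mathcomp Require Import zify ring.
Local Open Scope ring_scope.

Set Implicit Arguments.
Unset Strict Implicit.
Unset Printing Implicit Defensive.

Import GRing.Theory.

(** Evaluation in the Novikov algebra is the restriction of differential
    substitution, so a Novikov relation is a differential relation
    ([novikov_dependentP]). The converse turns an arbitrary differential
    relation g(f) = 0 into one lying in N_0<z_1, ..., z_p>.

    Give x^(s) the weight 1 - s. The derivation lowers weights by 1 and the
    elements of N_0 are homogeneous of weight 1, so f_i^(s) has the weight of
    z_i^(s) and substituting f respects weights. Every weight component of g is
    then a relation as well ([dsubst_component]), and g may be taken
    homogeneous of some weight w.

    It remains to multiply g by a monomial that moves it into N_0; since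
    multiplying by a monomial is injective ([dX_lreg]), the product is a nonzero
    relation. The elements s with N_0 s contained in N_0, called multipliers
    below, form a subalgebra containing the derivatives of N_0. With z one of
    the variables, it contains z^s x^(s+1) for each variable x
    ([multiplier_dX]), in particular x z''. So each derivative of positive order
    in a monomial is compensated by a power of z, each variable of order 0 by a
    factor z'', and every monomial m has exponents a, b such that m z^a z''^b is
    a multiplier; comparing weights, b - a is the weight of m
    ([multiplier_dmono]). As z z'' is itself a multiplier, a and b can be
    increased simultaneously, and monomials of equal weight admit common
    exponents ([multiplier_dmono_large]). Hence z (g z^a z''^b) lies in N_0 for
    suitable a and b. *)

(** * The weight grading *)

Section Weight.
Context {k : fieldType} {n : nat}.
Implicit Types (m : dmonom n) (f g : dpoly k n) (w : int).

Definition weight m : int := \sum_(v <- finsupp m) (1 - v.2%:Z) *+ m v.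

Lemma weightEw (d : {fset dvar n}) m : (finsupp m `<=` d)%fset ->
  weight m = \sum_(v <- d) (1 - v.2%:Z) *+ m v.
Proof.
move=> le; rewrite [LHS](big_fset_incl _ le) //= => v _.
by rewrite -cmE_eq0 => /eqP ->.
Qed.

Lemma weight1 : weight (@mone (dmonom n)) = 0.
Proof. by rewrite /weight mdom1 big_seq_fset0. Qed.

Lemma weightU v : weight (ucm v) = 1 - v.2%:Z.
Proof. by rewrite /weight mdomU big_seq_fset1 cmUU. Qed.

Lemma weightM m1 m2 : weight (mmul m1 m2) = weight m1 + weight m2.
Proof.
have h1 : (finsupp m1 `<=` finsupp (mmul m1 m2))%fset.
  by rewrite mdomD fsubsetUl.
have h2 : (finsupp m2 `<=` finsupp (mmul m1 m2))%fset.
  by rewrite mdomD fsubsetUr.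
rewrite (weightEw h1) (weightEw h2) -big_split /=.
by apply: eq_bigr => v _; rewrite cmM mulrnDr.
Qed.

Definition homogeneous w f : Prop := forall m, f@_m != 0 -> weight m = w.

Lemma homogeneous0 w : homogeneous w 0.
Proof. by move=> m; rewrite mcoeff0 eqxx. Qed.

Lemma homogeneousD w f g :
  homogeneous w f -> homogeneous w g -> homogeneous w (f + g).
Proof.
move=> hf hg m; rewrite dcoefD.
have [->|fm _] := eqVneq (f@_m) 0; last exact: hf.
by rewrite add0r; apply: hg.
Qed.

Lemma homogeneousZ w c f : homogeneous w f -> homogeneous w (c *: f).
Proof.
by move=> hf m; rewrite dcoefZ mulf_eq0 negb_or => /andP[_]; apply: hf.
Qed.

Lemma homogeneous_dmono m : homogeneous (weight m) (dmono k m).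
Proof.
by move=> m'; rewrite dcoef_dmono; have [->|] := eqVneq m m'; rewrite ?eqxx.
Qed.

Lemma homogeneous_sum w (h : dmonom n -> dpoly k n) f :
  (forall m, f@_m != 0 -> homogeneous w (h m)) ->
  homogeneous w (\sum_(m <- msupp f) f@_m *: h m).
Proof.
move=> hh; rewrite big_seq; elim/big_ind: _ => [|u v|m].
- exact: homogeneous0.
- exact: homogeneousD.
- by rewrite -mcoeff_neq0 => /hh; apply: homogeneousZ.
Qed.

Lemma homogeneousM w1 w2 f g :
  homogeneous w1 f -> homogeneous w2 g -> homogeneous (w1 + w2) (f * g).
Proof.
move=> hf hg; rewrite [f]dpolyE mulr_suml.
under eq_bigr do rewrite -scalerAl.
apply: homogeneous_sum => m1 /hf <-; rewrite [g]dpolyE mulr_sumr.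
under eq_bigr do rewrite -scalerAr.
apply: homogeneous_sum => m2 /hg <-; rewrite -dmonoM -weightM.
exact: homogeneous_dmono.
Qed.

Lemma homogeneousX w f e : homogeneous w f -> homogeneous (w *+ e) (f ^+ e).
Proof.
move=> hf; elim: e => [|e IHe]; last by rewrite exprS mulrS; apply: homogeneousM.
by rewrite mulr0n -weight1 expr0 -dmono1; apply: homogeneous_dmono.
Qed.

Lemma homogeneous_delta w f : homogeneous w f -> homogeneous (w - 1) (delta f).
Proof.
move=> hf; apply: homogeneous_sum => m /hf <-; rewrite -delta_dmono.
elim/(@dmonom_ind n): m {f hf} => [|v m IHm].
  by rewrite dmono1 delta1; apply: homogeneous0.
rewrite weightM dmonoM deltaM -/(dX k v) delta_dX.
apply: homogeneousD; last first.
  by rewrite -addrA; apply: homogeneousM => //; apply: homogeneous_dmono.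
suff -> : weight (ucm v) + weight m - 1 = weight (ucm (dshift v)) + weight m.
  by apply: homogeneousM; apply: homogeneous_dmono.
by rewrite !weightU /=; lia.
Qed.

(** In f g', the derivative g' of an element of weight 1 has weight 0, so the
    operation of the Novikov algebra preserves weight 1. *)
Lemma homogeneous_novikov0 (f : novikov0 k n) : homogeneous 1 f.
Proof.
elim/(@novikov0_gen_elim k n): f => [i||c g h IHg IHh|g h IHg IHh].
- have -> : 1 = weight (ucm ((i, 0%N) : dvar n)) by rewrite weightU subr0.
  exact: homogeneous_dmono.
- exact: homogeneous0.
- by apply: homogeneousD => //; apply: homogeneousZ.
- by rewrite -[1]addr0; apply: homogeneousM => //; apply: homogeneous_delta IHh.
Qed.

(** Written as a sum over the whole support, with the condition on the weight
    inside the terms, so that linearity comes from [dpoly_sum_is_linear]. *)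
Definition component w f : dpoly k n :=
  \sum_(m <- msupp f) f@_m *: (if weight m == w then dmono k m else 0).

Lemma component_is_linear w : linear (component w).
Proof. exact: dpoly_sum_is_linear. Qed.

HB.instance Definition _ w :=
  GRing.isLinear.Build k (dpoly k n) (dpoly k n) *:%R (component w)
    (component_is_linear w).

Lemma component_dmono w m :
  component w (dmono k m) = if weight m == w then dmono k m else 0.
Proof. exact: dpoly_sum_dmono. Qed.

Lemma dcoef_component w f m :
  (component w f)@_m = if weight m == w then f@_m else 0.
Proof.
elim/(@dpoly_ind k n): f => [|c m' f IHf]; first by rewrite linear0 mcoeff0 if_same.
rewrite linearD linearZ /= component_dmono !dcoefD !dcoefZ {}IHf dcoef_dmono.
have [<-|ne] := eqVneq m' m.
  by case: ifP => _; rewrite ?dcoef_dmono ?eqxx // mcoeff0 mulr0 addr0.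
by rewrite mulr0 add0r; case: ifP => _; rewrite ?dcoef_dmono ?(negPf ne) ?mcoeff0
  mulr0 add0r.
Qed.

End Weight.

(** * Substitution respects weights *)

Section GradedSubstitution.
Context {k : fieldType} {p n : nat} (f : 'I_p -> novikov0 k n).
Implicit Types (m : dmonom p) (g : dpoly k p).

(** f_i has the weight 1 of z_i, and each derivation lowers both weights
    by 1. *)
Lemma homogeneous_dsubst_mono m :
  homogeneous (weight m) (dsubst_mono (fun i => f i) m).
Proof.
rewrite /dsubst_mono /weight; elim/big_ind2: _ => [|w1 u1 w2 u2|v _].
- by rewrite -(@weight1 n) -dmono1; apply: homogeneous_dmono.
- by move=> h1 h2; apply: homogeneousM.
- apply: homogeneousX; elim: v.2 => [|s IHs] /=.
    by rewrite subr0; apply: homogeneous_novikov0.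
  have -> : 1 - s.+1%:Z = 1 - s%:Z - 1 by lia.
  exact: homogeneous_delta.
Qed.

(** A homogeneous relation is extracted from an arbitrary one by means of this
    commutation. *)
Lemma dsubst_component w g :
  dsubst (fun i => f i) (component w g) = component w (dsubst (fun i => f i) g).
Proof.
elim/(@dpoly_ind k p): g => [|c m g IHg]; first by rewrite !linear0.
rewrite !linearD !linearZ /= {}IHg; congr (_ *: _ + _).
rewrite component_dmono; apply: dpolyP => u.
rewrite dcoef_component dsubst_dmono.
case: (eqVneq (dsubst_mono (fun i => f i) m)@_u 0) => [E|/homogeneous_dsubst_mono ->].
  by rewrite E if_same; case: ifP; rewrite ?dsubst_dmono ?E // linear0 mcoeff0.
by case: ifP; rewrite ?dsubst_dmono // linear0 mcoeff0.
Qed.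

End GradedSubstitution.

(** * Multipliers of the Novikov algebra *)

Section Multipliers.
Context {k : fieldType} {n : nat}.
Implicit Types (m : dmonom n) (f g h s t : dpoly k n) (i j : 'I_n).

Definition multiplier s : Prop :=
  forall h, h \in novikov0_pred k n -> h * s \in novikov0_pred k n.

Lemma multiplier1 : multiplier 1.
Proof. by move=> h; rewrite mulr1. Qed.

Lemma multiplierM s t : multiplier s -> multiplier t -> multiplier (s * t).
Proof. by move=> hs ht h /hs /ht; rewrite mulrA. Qed.

Lemma multiplierX s e : multiplier s -> multiplier (s ^+ e).
Proof.
move=> hs; elim: e => [|e IHe]; first exact: multiplier1.
by rewrite exprS; apply: multiplierM.
Qed.

Lemma multiplierB s t : multiplier s -> multiplier t -> multiplier (s - t).
Proof. by move=> hs ht h hh; rewrite mulrBr rpredB ?hs ?ht. Qed.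

Lemma multiplierMn s e : multiplier s -> multiplier (s *+ e).
Proof. by move=> hs h hh; rewrite mulrnAr rpredMn ?hs. Qed.

(** f' is a multiplier because h f' is the Novikov product of h and f. *)
Lemma multiplier_delta f : f \in novikov0_pred k n -> multiplier (delta f).
Proof.
move=> /asboolP hf h /asboolP hh.
by apply/asboolP; apply: novikov0_gen_circ.
Qed.

Lemma deltaX f e : delta (f ^+ e.+1) = (f ^+ e * delta f) *+ e.+1.
Proof.
elim: e => [|e IHe]; first by rewrite expr1 expr0 mul1r.
rewrite exprS deltaM IHe -mulrnAl [RHS]mulrS -mulrnAl.
by rewrite mulrnAl mulrnAr mulrA -exprS [delta f * _]mulrC -mulrnAl.
Qed.

(** By induction on s: writing z, x for the two variables,
    P = z (z^s x^(s+1)) is in the Novikov algebra, so that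
    P' = (s+1) z' (z^s x^(s+1)) + z^(s+1) x^(s+2) is a multiplier; the first
    summand is a product of the multipliers z' and z^s x^(s+1), hence the second
    one is a multiplier too. *)
Lemma multiplier_dX i j (s : nat) :
  multiplier (dX k (i, 0%N) ^+ s * dX k (j, s.+1)).
Proof.
elim: s => [|s IHs].
  rewrite mul1r -(delta_dX (j, 0%N)).
  by apply: multiplier_delta; apply: nvar_subproof.
have hz : multiplier (dX k (i, 1%N)).
  by rewrite -(delta_dX (i, 0%N)); apply: multiplier_delta; apply: nvar_subproof.
have := multiplier_delta (IHs _ (nvar_subproof i)).
move=> hd; have := multiplierB hd (multiplierMn s.+1 (multiplierM hz IHs)).
congr multiplier; rewrite mulrA -exprS deltaM deltaX !delta_dX /=.
ring.
Qed.

(** A factor x^(s+1) of m is paired with z^s and a factor x with z''; either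
    pairing changes both sides of the weight equation equally. *)
Lemma multiplier_dmono i m : exists a b : nat,
  weight m = b%:Z - a%:Z /\
  multiplier (dmono k m * dX k (i, 0%N) ^+ a * dX k (i, 2%N) ^+ b).
Proof.
elim/(@dmonom_ind n): m => [|[j [|s]] m [a [b [wm hm]]]].
- exists 0%N, 0%N; rewrite weight1 dmono1 !expr0 !mulr1; split=> //.
  exact: multiplier1.
(* order 0: x is absorbed by one more factor z'' *)
- exists a, b.+1; split; first by rewrite weightM weightU wm /=; lia.
  have := multiplierM hm (multiplier_dX j i 1%N); congr multiplier.
  rewrite dmonoM -/(dX k (j, 0%N)) expr1 exprS.
  ring.
(* order s + 1: x^(s+1) is absorbed by s more factors z *)
- exists (a + s)%N, b; split; first by rewrite weightM weightU wm /=; lia.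
  have := multiplierM hm (multiplier_dX i j s); congr multiplier.
  rewrite dmonoM -/(dX k (j, s.+1)) exprD.
  ring.
Qed.

(** If a', b' are exponents for m and b - a = b' - a', then for N >= a' the
    exponents N + a and N + b exceed a' and b' by the same number r, and
    the excess (z z'')^r is a multiplier. *)
Lemma multiplier_dmono_large i (ms : seq (dmonom n)) a b :
  (forall m, m \in ms -> weight m = b%:Z - a%:Z) ->
  exists N, forall m, m \in ms ->
    multiplier (dmono k m * dX k (i, 0%N) ^+ (N + a) * dX k (i, 2%N) ^+ (N + b)).
Proof.
move=> wms.
pose P m N := forall M, (N <= M)%N -> weight m = b%:Z - a%:Z ->
  multiplier (dmono k m * dX k (i, 0%N) ^+ (M + a) * dX k (i, 2%N) ^+ (M + b)).
have PN m : exists N, P m N.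
  have [a' [b' [wm hm]]] := multiplier_dmono i m.
  exists a' => M le_aM; rewrite wm => eqw.
  pose r := (M + a - a')%N.
  have := multiplierM hm (multiplierX r (multiplier_dX i i 1%N)).
  have -> : (M + a = a' + r)%N by rewrite /r; lia.
  have -> : (M + b = b' + r)%N by rewrite /r; lia.
  congr multiplier; rewrite expr1 !exprD exprMn; ring.
have [N hN] := choice PN.
exists (\max_(m <- ms) N m)%N => m mms.
by apply: hN; [apply: leq_bigmax_seq | apply: wms].
Qed.

Lemma dcoef_mul_dX f (v : dvar n) m : (f * dX k v)@_(mmul m (ucm v)) = f@_m.
Proof.
elim/(@dpoly_ind k n): f => [|c m' f IHf]; first by rewrite mul0r !mcoeff0.
rewrite mulrDl -scalerAl -dmonoM !dcoefD !dcoefZ IHf !dcoef_dmono.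
congr (_ * (nat_of_bool _)%:R + _); apply/eqP/eqP => [/eqP/cmP E|-> //].
by apply/eqP/cmP => w; have := E w; rewrite !cmM => /addIn.
Qed.

(** Multiplication by a variable shifts coefficients injectively. *)
Lemma dX_lreg (v : dvar n) : GRing.lreg (dX k v).
Proof.
move=> f g; rewrite ![dX k v * _]mulrC => E.
by apply: dpolyP => m; rewrite -(dcoef_mul_dX f v) E dcoef_mul_dX.
Qed.

End Multipliers.

(** * Novikov relations as differential relations *)

(** An explicit evaluation map; by uniqueness it is the only one. *)
Lemma is_novikov_eval_dsubst (k : fieldType) (p n : nat)
    (f : 'I_p -> novikov0 k n) :
  is_novikov_eval f (fun u => (u.1, Novikov0 (dsubst_novikov0 f u.2))).
Proof.
split=> [c [a g] [b h]|[a g] [b h]||i]; congr pair; apply: val_inj => /=.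
- by rewrite linearP.
- by rewrite !linearD !linearZ /= /dcirc rmorphM /= dsubst_delta.
- by rewrite linear0.
- by rewrite dsubst_dX.
Qed.

(** The constant term of a relation vanishes since evaluation preserves it, so
    the formal identity adds no relations. *)
Lemma novikov_dependentP (k : fieldType) (p n : nat)
    (f : 'I_p -> novikov0 k n) :
  novikov_dependent f <->
  exists2 g : novikov0 k p, val g != 0 & dsubst (fun i => f i) (val g) = 0.
Proof.
split=> [[phi [ev [[c g] [h0 phih]]]]|[g g0 fg]].
  move: phih; rewrite (is_novikov_eval_uniq ev (is_novikov_eval_dsubst f)).
  case=> /= c0 fg; exists g => //; apply: contraNneq h0 => g0.
  by rewrite c0; apply/eqP; congr pair; apply: val_inj.
exists (fun u => (u.1, Novikov0 (dsubst_novikov0 f u.2))).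
split; first exact: is_novikov_eval_dsubst.
exists (ninj g); split; last by congr pair; apply: val_inj.
by apply: contraNneq g0 => -[->].
Qed.

Lemma dpoly_no_vars (k : fieldType) (g : dpoly k 0) : g = g@_mone *: 1.
Proof.
have m1 (m : dmonom 0) : m = mone by elim/(@dmonom_ind 0): m => // -[[]].
by apply: dpolyP => m; rewrite dcoefZ -dmono1 dcoef_dmono (m1 m) eqxx mulr1.
Qed.

Theorem theorem3 (k : fieldType) (hk : [pchar k] =i pred0) (n p : nat)
    (f : 'I_p -> novikov0 k n) :
  novikov_dependent f <-> diff_alg_dependent (fun i => novikov0_val (f i)).
Proof.
apply: (iff_trans (novikov_dependentP f)); split=> [[g g0 fg]|[g [g0 fg]]].
  by exists (val g).
(* Without variables g is a nonzero constant, which is no relation; otherwise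
   the first variable serves as z. *)
case: p f g g0 fg => [|p] f g g0 fg.
  move: fg; rewrite (dpoly_no_vars g) linearZ rmorph1 => fg.
  suff c0 : g@_mone = 0 by case/eqP: g0; rewrite (dpoly_no_vars g) c0 scale0r.
  have /(congr1 (fun u : dpoly k n => u@_mone)) := fg.
  by rewrite dcoefZ -dmono1 dcoef_dmono eqxx mulr1 mcoeff0.
have [m0 gm0] : exists m0, g@_m0 != 0.
  apply: contrapT => /forallNP gz; move/eqP: g0; apply; apply: dpolyP => m.
  by rewrite mcoeff0; apply/eqP/negP => /negP /(gz m).
have [a [b [wm0 _]]] := multiplier_dmono (k := k) ord0 m0.
pose g1 := component (weight m0) g.
have wg1 m : m \in msupp g1 -> weight m = b%:Z - a%:Z.
  by rewrite -mcoeff_neq0 dcoef_component wm0; case: ifP => [/eqP|]; rewrite ?eqxx.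
have [N hN] := multiplier_dmono_large (k := k) ord0 wg1.
pose z := dX k ((ord0, 0%N) : dvar p.+1).
pose z2 := dX k ((ord0, 2%N) : dvar p.+1).
(* The extra factor z is the element of N_0 to which multipliers are applied. *)
pose u := z * z ^+ (N + a) * z2 ^+ (N + b).
have hu : u * g1 \in novikov0_pred k p.+1.
  rewrite [g1]dpolyE mulr_sumr big_seq rpred_sum // => m /hN hm.
  rewrite -scalerAr rpredZ //.
  have -> : u * dmono k m =
      z * (dmono k m * z ^+ (N + a) * z2 ^+ (N + b)) by rewrite /u; ring.
  exact: hm (nvar_subproof ord0).
exists (Novikov0 hu) => /=; last first.
  by rewrite rmorphM /= dsubst_component fg linear0 mulr0.
have lu : GRing.lreg u.
  by apply/lregM/lregX/dX_lreg; apply/lregM/lregX/dX_lreg; apply: dX_lreg.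
rewrite (mulrI_eq0 _ lu); apply: contraNneq gm0 => g10.
have := dcoef_component (weight m0) g m0.
by rewrite -/g1 g10 mcoeff0 eqxx => <-.
Qed.
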